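(* Let $E,Q\in M_n(\mathbb C)$ be such that $E^TQ$ is symmetric and at least one of $E$ and $Q$ is nonsingular. Then there exist $U,V\in GL_n(\mathbb C)$ such that $$(UEV,U^{-T}QV)=\bigoplus_{i=1}^{n}(A_i,B_i),$$ where each $(A_i,B_i)$ is a pair of $1\times1$ matrices with $(A_i,B_i)\in\{(1,1),(1,0)\}$ if $E$ is nonsingular, and $(A_i,B_i)\in\{(1,1),(0,1)\}$ if $Q$ is nonsingular. These canonical forms are uniquely determined by $(E,Q)$ up to permutation of summands.
   Context: $M_n(\mathbb C)$ is the set of $n\times n$ complex matrices, $GL_n(\mathbb C)$ the nonsingular ones, $A^{-T}=(A^{-1})^T$. The direct sum of pairs is $(A,B)\oplus(C,D):=(A\oplus C,B\oplus D)$, where $\oplus$ on matrices is the block-diagonal direct sum. *)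

(* Defs.v *)
From HB Require Import structures.
From mathcomp Require Import all_boot all_order all_algebra all_fingroup.
From mathcomp Require Import reals.
From mathcomp Require Import complex.

Set Implicit Arguments.
Unset Strict Implicit.
Unset Printing Implicit Defensive.

Import Order.TTheory GRing.Theory Num.Theory.

Local Open Scope ring_scope.

Lemma sum_ord1 (n : nat) : (\sum_(i < n) 1 = n)%N.
Proof. by rewrite sum1_card card_ord. Qed.

(* [\mxdiag] lives in ['M_(\sum_(i < n) 1)], which is only propositionally
   ['M_n]; hence the cast. *)
Definition dsum (K : nmodType) (n : nat) (A : 'I_n -> 'M[K]_1) : 'M[K]_n :=
  castmx (sum_ord1 n, sum_ord1 n) (\mxdiag_(i < n) A i).

Definition dsum_pairs (K : nmodType) (n : nat)
    (S : 'I_n -> 'M[K]_1 * 'M[K]_1) : 'M[K]_n * 'M[K]_n :=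
  (dsum (fun i => (S i).1), dsum (fun i => (S i).2)).

Definition reduces_to (K : fieldType) (n : nat) (E Q : 'M[K]_n)
    (S : 'I_n -> 'M[K]_1 * 'M[K]_1) : Prop :=
  exists U V : 'M[K]_n, [/\ U \in unitmx, V \in unitmx &
    (U *m E *m V, (invmx U)^T *m Q *m V) = dsum_pairs S].

Definition summands_in (K : fieldType) (n : nat)
    (S : 'I_n -> 'M[K]_1 * 'M[K]_1) (L : seq ('M[K]_1 * 'M[K]_1)) : Prop :=
  forall i, S i \in L.

Lemma dsumE (K : pzSemiRingType) (n : nat) (A : 'I_n -> 'M[K]_1) :
  dsum A = diag_mx (\row_i A i 0 0).
Proof.
have -> : dsum A = castmx (sum_ord1 n, sum_ord1 n) (diag_mx (\mxrow_i A i)).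
  rewrite diag_mxrow /dsum; congr castmx; apply/eq_mxdiagP => i.
  by apply/matrixP => a b; rewrite !ord1 mxE eqxx.
apply/matrixP => i j; rewrite castmxE !mxE /=.
set k := cast_ord _ i; congr (_ *+ _).
have rkE : (\sum_(l < n | (l < i)%N) 1 = i)%N.
  by rewrite -(big_ord_widen n (fun=> 1%N) (ltnW (ltn_ord i))) sum_ord1.
have -> : k = @tagnat.Rank n (fun=> 1%N) i ord0.
  apply/val_inj/esym/(etrans (tagnat.RankEsum _)).
  by rewrite rkE addn0.
by rewrite tagnat.Rank1K !ord1.
Qed.

(* Main.v *)
(** Since [(U E V)^T (U^-T Q V) = V^T (E^T Q) V], the pair transforms through
    the congruence class of the symmetric matrix [E^T Q]. Over an algebraically
    closed field of characteristic not 2 this matrix is congruent to a diagonal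
    0/1 matrix [V^T E^T Q V = D]; if [E] is nonsingular, [U := (E V)^-1] gives
    [(1, D)], and if [Q] is nonsingular, [U := (Q V)^T] gives [(D, 1)].
    Conversely the ranks of [E] and [Q] determine how many times each of the
    summands (1,1), (1,0) and (0,1) occurs. *)

Require Import Defs.
From mathcomp Require Import all_boot all_order all_algebra all_fingroup.
From mathcomp Require Import reals.
From mathcomp Require Import complex.

Set Implicit Arguments.
Unset Strict Implicit.
Unset Printing Implicit Defensive.

Import Order.TTheory GRing.Theory Num.Theory.

Local Open Scope ring_scope.

(** * Diagonalising a symmetric matrix by congruence *)

Lemma sym_mx_anisotropic (F : fieldType) (n : nat) (A : 'M[F]_n) :
  2 != 0 :> F -> A^T = A -> A != 0 ->
  exists v : 'rV_n, (v *m A *m v^T) 0 0 != 0.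
Proof.
move=> nz2 symA /matrix0Pn[i [j nzAij]].
have qE (k l : 'I_n) :
    ((delta_mx 0 k : 'rV_n) *m A *m (delta_mx 0 l : 'rV_n)^T) 0 0 = A k l.
  by rewrite -rowE trmx_delta -colE !mxE.
have [Aii0|nzAii] := eqVneq (A i i) 0; last by exists (delta_mx 0 i); rewrite qE.
have [Ajj0|nzAjj] := eqVneq (A j j) 0; last by exists (delta_mx 0 j); rewrite qE.
(* The form takes the value [2 A i j] at [e_i + e_j]. *)
exists (delta_mx 0 i + delta_mx 0 j).
rewrite linearD /= mulmxDl mulmxDr !mulmxDl 3![(_ + _ : 'M_1) 0 0]mxE !qE.
have -> : A j i = A i j by rewrite -[in LHS]symA mxE.
by rewrite Aii0 Ajj0 add0r addr0 -mulr2n -mulr_natl mulf_neq0.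
Qed.

Lemma closed_field_sqrt (F : closedFieldType) (a : F) : exists b, b ^+ 2 = a.
Proof.
(* The coefficients encode the monic equation [b ^+ 2 = a + 0 * b]. *)
have [b bE] := @solve_monicpoly F 2 (fun i => if i == 0 then a else 0) isT.
by exists b; rewrite bE !big_ord_recl big_ord0 /= mul0r !addr0 expr0 mulr1.
Qed.

(** An anisotropic vector is rescaled by a square root of the inverse of its value. *)
Lemma sym_mx_unit_vector (F : closedFieldType) (n : nat) (A : 'M[F]_n) :
  2 != 0 :> F -> A^T = A -> A != 0 ->
  exists v : 'rV_n, v *m A *m v^T = 1%:M.
Proof.
move=> nz2 symA nzA; have [v nzq] := sym_mx_anisotropic nz2 symA nzA.
have [b bE] := closed_field_sqrt ((v *m A *m v^T) 0 0)^-1.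
exists (b *: v); rewrite linearZ /= -scalemxAr -!scalemxAl scalerA -expr2 bE.
by rewrite [X in _ *: X]mx11_scalar scale_scalar_mx mulVf.
Qed.

(** Lets a chosen vector start a new basis: a map sending the first basis vector to [v] keeps the
    rank of that vector, so some invertible matrix agrees with it there. *)
Lemma row_vector_complete (F : fieldType) (n : nat) (v : 'rV[F]_(1 + n)) :
  v != 0 -> exists2 P : 'M_(1 + n), P \in unitmx & usubmx P = v.
Proof.
move=> nzv; have e0E (M : 'M[F]_(1 + n)) : delta_mx 0 0 *m M = usubmx M.
  by rewrite -rowE; apply/rowP => j; rewrite !mxE; congr (M _ _); apply: val_inj.
pose f : 'M_(1 + n) := col_mx v 0.
have vE : delta_mx 0 0 *m f = v by rewrite e0E col_mxKu.
have [|P uP] := @complete_unitmx F 1 (1 + n) (delta_mx 0 0) f.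
  by rewrite vE mxrank_delta rank_rV nzv.
by rewrite vE e0E => /esym; exists P.
Qed.

(** Induction on the size: a vector of value 1 becomes the first basis vector, the pivot 1 clears
    the rest of its row and column, and the Schur complement is again symmetric. *)
Lemma sym_mx_congr_diag01 (F : closedFieldType) (n : nat) (A : 'M[F]_n) :
  2 != 0 :> F -> A^T = A ->
  exists P d, [/\ P \in unitmx, P *m A *m P^T = diag_mx d
                & forall i, d 0 i \in [:: 1; 0]].
Proof.
move=> nz2; elim: n A => [|n IHn] A symA.
  exists 1%:M, 0; rewrite unitmx1; split=> // [|[]//].
  by apply/matrixP => -[].
have [->|nzA] := eqVneq A 0.
  exists 1%:M, 0; rewrite unitmx1 mulmx0 mul0mx linear0; split=> // i.
  by rewrite mxE !inE eqxx orbT.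
have [v vE] := sym_mx_unit_vector nz2 symA nzA.
have nzv : v != 0.
  apply/eqP => v0; move: vE; rewrite v0 !mul0mx => /esym/eqP.
  by rewrite (negPf (oner_neq0 _)).
have [P uP Pv] := @row_vector_complete F n v nzv.
(* [A1] is [A] retyped at size [1 + n], so that block operations apply. *)
pose A1 : 'M_(1 + n) := A; pose B := P *m A1 *m P^T.
have symB : B^T = B by rewrite /B !trmx_mul trmxK symA mulmxA.
have Bul : ulsubmx B = 1%:M.
  rewrite -vE -Pv /ulsubmx /B -mul_usub_mx -mul_usub_mx.
  by rewrite -mulmx_lsub trmx_usub.
pose b := ursubmx B.
have Bdl : dlsubmx B = b^T by rewrite /b trmx_ursub symB.
pose C := drsubmx B.
have BE : B = block_mx 1%:M b b^T C by rewrite -Bul -Bdl submxK.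
have symC : C^T = C by rewrite /C trmx_drsub symB.
(* One step of block elimination: [L] subtracts [b^T] times the first row from the rows below. *)
pose L : 'M_(1 + n) := block_mx 1%:M 0 (- b^T) 1%:M.
have uL : L \in unitmx by rewrite unitmxE det_lblock !det1 mulr1 unitr1.
have LBL : L *m B *m L^T = block_mx 1%:M 0 0 (C - b^T *m b).
  rewrite BE /L tr_block_mx !mulmx_block !(trmx1, trmx0) linearN /= trmxK.
  rewrite !(mul1mx, mulmx1, mul0mx, mulmx0, addr0, add0r, mulNmx, mulmxN).
  by rewrite !addNr mul0mx oppr0 add0r addrC.
have [|P' [d [uP' P'E d01]]] := IHn (C - b^T *m b).
  by rewrite linearB /= trmx_mul trmxK symC.
pose M : 'M_(1 + n) := block_mx 1%:M 0 0 P'.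
have uM : M \in unitmx by rewrite unitmxE det_ublock det1 mul1r -unitmxE.
pose D : 'rV_(1 + n) := row_mx 1%:M d.
have DE : diag_mx D = block_mx 1%:M 0 0 (diag_mx d).
  rewrite diag_mx_row; congr block_mx.
  by apply/matrixP=> i j; rewrite !ord1 !mxE.
have D01 i : D 0 i \in [:: 1; 0].
  rewrite /D; case: (split_ordP i) => k ->; last by rewrite row_mxEr.
  by rewrite row_mxEl ord1 mxE eqxx !inE eqxx.
exists (M *m L *m P), D; split=> //.
- by rewrite !unitmx_mul uP uL uM.
- have -> : M *m L *m P *m A *m (M *m L *m P)^T = M *m (L *m B *m L^T) *m M^T.
    by rewrite /B !trmx_mul !mulmxA.
  rewrite LBL /M tr_block_mx !mulmx_block !(trmx1, trmx0).
  by rewrite !(mul1mx, mulmx1, mul0mx, mulmx0, addr0, add0r) P'E -DE.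
Qed.

(** * Ranks as invariants and the multiplicities of the summands *)

Lemma mxrank_dsum (F : fieldType) (n : nat) (A : 'I_n -> 'M[F]_1) :
  \rank (dsum A) = #|[set i | A i != 0]|.
Proof.
rewrite /dsum; move: (sum_ord1 n) => e.
(* With the source size a variable [m], the equality can be eliminated and the cast disappears. *)
have -> m (M : 'M[F]_m) (em : m = n) : \rank (castmx (em, em) M) = \rank M.
  by case: _ / em.
rewrite rank_mxdiag -sum1dep_card [RHS]big_mkcond /=.
by apply: eq_bigr => i _; rewrite rank_rV; case: (_ != 0).
Qed.

Lemma dsum_scalar (K : pzSemiRingType) (n : nat) (d : 'rV[K]_n) :
  dsum (fun i => (d 0 i)%:M) = diag_mx d.
Proof. by rewrite dsumE; congr diag_mx; apply/rowP => i; rewrite !mxE mulr1n. Qed.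

Lemma dsum1 (K : pzSemiRingType) (n : nat) :
  dsum (fun=> 1 : 'M[K]_1) = 1%:M :> 'M_n.
Proof.
by rewrite dsumE -diag_const_mx; congr diag_mx; apply/rowP => i; rewrite !mxE.
Qed.

Lemma reduces_to_rank (F : fieldType) (n : nat) (E Q : 'M[F]_n)
    (S : 'I_n -> 'M[F]_1 * 'M[F]_1) :
  reduces_to E Q S ->
  #|[set i | (S i).1 != 0]| = \rank E /\ #|[set i | (S i).2 != 0]| = \rank Q.
Proof.
case=> U [V [uU uV [EE QE]]]; rewrite -!mxrank_dsum -EE -QE.
have uUT : (invmx U)^T \in unitmx by rewrite unitmx_tr unitmx_inv.
have rankMl W (M : 'M[F]_n) : W \in unitmx -> \rank (W *m M) = \rank M.
  by rewrite -row_full_unit => /eqmxMfull->.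
by rewrite -row_free_unit in uV; rewrite !(mxrankMfree _ uV) !rankMl.
Qed.

(** Equal multiplicities make the two tuples of values permutations of each other. *)
Lemma card_eq_perm (T : eqType) (n : nat) (f g : 'I_n -> T) :
  (forall x, #|[set i | f i == x]| = #|[set i | g i == x]|) ->
  exists s : {perm 'I_n}, forall i, g i = f (s i).
Proof.
move=> fg; have cE h x : count_mem x [tuple h i | i < n] = #|[set i | h i == x]|.
  by rewrite count_map val_ord_tuple -sum1_count -sum1dep_card big_enum_cond.
have /tuple_permP[s sE] : perm_eq [tuple g i | i < n] [tuple f i | i < n].
  by apply/allP => x _ /=; rewrite !cE fg.
exists s => i; have /(congr1 (fun t => tnth t i)) := val_inj sE.
by rewrite !tnth_mktuple.
Qed.

(** The union of the two admissible lists, so that two forms can be compared even when they come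
    from different lists. *)
Definition canonical_pairs (F : fieldType) : seq ('M[F]_1 * 'M[F]_1) :=
  [:: (1, 1); (1, 0); (0, 1)].

(** A zero first entry singles out (0,1) and a zero second entry (1,0); the count of (1,1) is what
    remains. *)
Lemma canonical_pairs_card (F : fieldType) (n : nat)
    (S S' : 'I_n -> 'M[F]_1 * 'M[F]_1) :
  summands_in S (canonical_pairs F) -> summands_in S' (canonical_pairs F) ->
  #|[set i | (S i).1 != 0]| = #|[set i | (S' i).1 != 0]| ->
  #|[set i | (S i).2 != 0]| = #|[set i | (S' i).2 != 0]| ->
  forall x, #|[set i | S i == x]| = #|[set i | S' i == x]|.
Proof.
move=> SL S'L eq1 eq2 x.
have nz1 := negPf (oner_neq0 'M[F]_1).
have nz1' : (0 == 1 :> 'M[F]_1) = false by rewrite eq_sym.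
have split3 (T : 'I_n -> _) i : summands_in T (canonical_pairs F) ->
    [/\ (T i == (1, 0)) = ((T i).2 == 0), (T i == (0, 1)) = ((T i).1 == 0)
       & (T i == (1, 1)) = ~~ (((T i).2 == 0) || ((T i).1 == 0))].
  move/(_ i); rewrite !inE.
  by case/or3P=> /eqP->; rewrite !xpair_eqE /= ?eqxx ?nz1 ?nz1'.
have E10 (T : 'I_n -> _) : summands_in T (canonical_pairs F) ->
    [set i | T i == (1, 0)] = ~: [set i | (T i).2 != 0].
  by move=> TL; apply/setP => i; rewrite !inE negbK; case: (split3 T i TL).
have E01 (T : 'I_n -> _) : summands_in T (canonical_pairs F) ->
    [set i | T i == (0, 1)] = ~: [set i | (T i).1 != 0].
  by move=> TL; apply/setP => i; rewrite !inE negbK; case: (split3 T i TL).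
have E11 (T : 'I_n -> _) : summands_in T (canonical_pairs F) ->
    #|[set i | T i == (1, 1)]| =
    (#|[set i | (T i).1 != 0%R]| - #|~: [set i | (T i).2 != 0%R]|)%N.
  (* The summands (1,0) are among those with nonzero first entry, so the natural-number subtraction
     does not truncate. *)
  move=> TL; rewrite -E10 // -cardsDS; last first.
    apply/subsetP => i; rewrite !inE => /eqP->; exact: oner_neq0.
  apply: eq_card => i; rewrite !inE.
  by case: (split3 T i TL) => -> _ ->; rewrite negb_or.
have cardC (A B : {set 'I_n}) : #|A| = #|B| -> #|~: A| = #|~: B|.
  by move=> AB; rewrite [LHS]cardsCs [RHS]cardsCs !setCK AB.
have [|xL] := boolP (x \in canonical_pairs F).
  by rewrite !inE => /or3P[] /eqP->; rewrite ?E11 ?E10 ?E01 // ?eq1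
    (cardC _ _ eq1, cardC _ _ eq2).
have Ex0 (T : 'I_n -> _) : summands_in T (canonical_pairs F) ->
    #|[set i | T i == x]| = 0%N.
  move=> TL; apply/eqP; rewrite cards_eq0; apply/eqP/setP => i; rewrite !inE.
  by apply: contraNF xL => /eqP <-.
by rewrite !Ex0.
Qed.

(** * Existence of the canonical form, then the theorem *)

Lemma reduces_to_unitl (F : closedFieldType) (n : nat) (E Q : 'M[F]_n) :
  2 != 0 :> F -> (E^T *m Q)^T = E^T *m Q -> E \in unitmx ->
  exists2 S, reduces_to E Q S & summands_in S [:: (1, 1); (1, 0)].
Proof.
move=> nz2 sym uE; have [P [d [uP PE d01]]] := sym_mx_congr_diag01 nz2 sym.
have uEP : E *m P^T \in unitmx by rewrite unitmx_mul uE unitmx_tr.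
exists (fun i => (1, (d 0 i)%:M)) => [|i]; last first.
  by have:= d01 i; rewrite !inE => /orP[]/eqP->; rewrite ?raddf0 eqxx ?orbT.
exists (invmx (E *m P^T)), P^T; rewrite unitmx_inv unitmx_tr; split=> //.
rewrite /dsum_pairs /= dsum1 dsum_scalar -PE.
rewrite -[invmx _ *m _ *m _]mulmxA mulVmx //.
by rewrite invmxK trmx_mul trmxK !mulmxA.
Qed.

Lemma reduces_to_unitr (F : closedFieldType) (n : nat) (E Q : 'M[F]_n) :
  2 != 0 :> F -> (E^T *m Q)^T = E^T *m Q -> Q \in unitmx ->
  exists2 S, reduces_to E Q S & summands_in S [:: (1, 1); (0, 1)].
Proof.
move=> nz2 sym uQ; have [P [d [uP PE d01]]] := sym_mx_congr_diag01 nz2 sym.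
have uQP : Q *m P^T \in unitmx by rewrite unitmx_mul uQ unitmx_tr.
exists (fun i => ((d 0 i)%:M, 1)) => [|i]; last first.
  by have:= d01 i; rewrite !inE => /orP[]/eqP->; rewrite ?raddf0 eqxx ?orbT.
exists (Q *m P^T)^T, P^T; rewrite !unitmx_tr; split=> //.
rewrite /dsum_pairs /= dsum1 dsum_scalar -PE -trmx_inv trmxK.
rewrite -[invmx _ *m _ *m _]mulmxA mulVmx //.
(* The first component is [P *m Q^T *m E *m P^T]; symmetry turns [Q^T *m E] into [E^T *m Q]. *)
by rewrite -sym !trmx_mul !trmxK !mulmxA.
Qed.

Theorem theorem3p5 (R : realType) (n : nat) (E Q : 'M[R[i]]_n)
    (symEQ : (E^T *m Q)^T = E^T *m Q)
    (nonsing : E \in unitmx \/ Q \in unitmx) :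
  (exists S : 'I_n -> 'M[R[i]]_1 * 'M[R[i]]_1,
     [/\ reduces_to E Q S,
         E \in unitmx -> summands_in S [:: (1, 1); (1, 0)] &
         Q \in unitmx -> summands_in S [:: (1, 1); (0, 1)]])
  /\
  (forall S S' : 'I_n -> 'M[R[i]]_1 * 'M[R[i]]_1,
     summands_in S [:: (1, 1); (1, 0)] \/ summands_in S [:: (1, 1); (0, 1)] ->
     summands_in S' [:: (1, 1); (1, 0)] \/ summands_in S' [:: (1, 1); (0, 1)] ->
     reduces_to E Q S -> reduces_to E Q S' ->
     exists s : {perm 'I_n}, forall i, S' i = S (s i)).
Proof.
have nz2 : 2 != 0 :> R[i] by rewrite pnatr_eq0.
split.
  have [uE|nuE] := boolP (E \in unitmx); last first.
    case: nonsing => [uE|uQ]; first by rewrite uE in nuE.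
    by have [S redS SL] := reduces_to_unitr nz2 symEQ uQ; exists S.
  have [S redS SL] := reduces_to_unitl nz2 symEQ uE.
  (* If [Q] is nonsingular too, its full rank makes every second entry nonzero, so every summand is
     (1,1) and lies in both lists. *)
  exists S; split=> // uQ i.
  have [_] := reduces_to_rank redS; rewrite mxrank_unit //.
  rewrite -[n in RHS]card_ord -cardsT => /eqP rS.
  have /eqP/setP/(_ i) : [set i | (S i).2 != 0] == [set: 'I_n].
    by rewrite eqEcard subsetT (eqP rS) leqnn.
  by rewrite !inE; have:= SL i; rewrite !inE => /orP[]/eqP->; rewrite eqxx.
have canL T : summands_in T [:: (1, 1); (1, 0)] \/
    summands_in T [:: (1, 1); (0, 1)] -> summands_in T (canonical_pairs R[i]).
  by case=> TL i; have:= TL i; rewrite !inE => /orP[]->; rewrite ?orbT.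
move=> S S' /canL SL /canL S'L /reduces_to_rank[rE rQ] /reduces_to_rank[rE' rQ'].
by apply/card_eq_perm/canonical_pairs_card; rewrite // ?rE ?rE' ?rQ ?rQ'.
Qed.
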